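(* Let $G^v$ and $H^w$ be finite simple rooted graphs, and let $m$ be a nonnegative integer. Then the sequences of independence polynomials \[ \left(I((G^v:H^w)_{k}^{(m)};x)\right)_{k\geq 0} \quad \text{and} \quad \left(I((G^v:H^w)_{k,\,k+m+1};x)\right)_{k\geq 0} \] are linearly recurrent, with characteristic polynomials \[ \chi_{m}(r) = \prod_{j=0}^{m} \bigl(r - I(H\setminus w;x)^{\,m-j} I(H;x)^{\,j}\bigr) \quad \text{and} \quad \chi(r) = \bigl(r + I(H\setminus w;x) I(H;x)\bigr) \chi_2(r), \] respectively, where $\chi_2(r)=\prod_{j=0}^{2} \bigl(r - I(H\setminus w;x)^{\,2-j} I(H;x)^{\,j}\bigr)$.
   Context: All graphs are finite and simple. The independence polynomial $I(G;x)=\sum_{i\ge0}s_ix^i$, $s_i$ the number of independent sets of size $i$. A rooted graph $G^v$ is a graph with distinguished vertex $v$; $H\setminus w$ is $H$ with $w$ deleted. For a rooted graph $H^w$ and integer $k\ge 0$, the scale graph $Z_k(H^w)$ is obtained from a new vertex $v_0$ and $k$ disjoint copies of $H$ by joining $v_0$ to the root $w$ of each copy. For disjoint rooted graphs $G^v,H^w$, $(G^v:H^w)_k$ is the disjoint union of $G$ and $Z_k(H^w)$ plus the edge $vv_0$, rooted at $v$. Recursively, $(G^v:H^w)_{i_1,\ldots,i_j}=((G^v:H^w)_{i_1,\ldots,i_{j-1}}^v:H^w)_{i_j}$ (empty sequence giving $G^v$), and $(G^v:H^w)_k^{(m)}$ is $(G^v:H^w)_{k,\ldots,k}$ with $k$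 repeated $m$ times. A sequence $(p_k)_{k\ge0}$ is linearly recurrent with characteristic polynomial $r^n - c_{n-1}r^{n-1}-\cdots-c_0$ if $p_k = c_{n-1}p_{k-1}+\cdots+c_0p_{k-n}$ for all $k\ge n$. *)

(* Defs.v *)
From mathcomp Require Import all_boot ssralg ssrint poly.

Set Implicit Arguments.
Unset Strict Implicit.
Unset Printing Implicit Defensive.

Import GRing.Theory.
Local Open Scope ring_scope.

Record sgraph := SGraph {
  vertex :> finType;
  edge : rel vertex;
  edge_sym : symmetric edge;
  edge_irrefl : irreflexive edge }.
Arguments edge {s} _ _.

Record rooted_graph := RootedGraph {
  rooted_sgraph :> sgraph;
  root_vertex : rooted_sgraph }.
Arguments root_vertex : clear implicits.

Definition independent (G : sgraph) (S : {set G}) : bool :=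
  [forall x in S, forall y in S, ~~ edge x y].

Definition indep_count (G : sgraph) (i : nat) : nat :=
  #|[set S : {set G} | independent S & #|S| == i]|.

Definition indep_poly (G : sgraph) : {poly int} :=
  \sum_(i < #|G|.+1) (indep_count G i)%:R *: 'X^i.

Section DeleteVertex.
Variables (G : sgraph) (w : G).

Definition del_vertex : finType := {x : G | x != w}.
Definition del_edge (x y : del_vertex) : bool := edge (val x) (val y).

Lemma del_edge_sym : symmetric del_edge.
Proof. by move=> x y; exact: edge_sym. Qed.

Lemma del_edge_irrefl : irreflexive del_edge.
Proof. by move=> x; exact: edge_irrefl. Qed.

Definition delete_vertex : sgraph := SGraph del_edge_sym del_edge_irrefl.
End DeleteVertex.

Section ScaleGraph.
Variables (H : rooted_graph) (k : nat).

(* [None] is the new vertex v_0, and [Some (i, h)] is the vertex h of the i-th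
   copy of H. *)
Definition scale_vertex : finType := option ('I_k * H)%type.

Definition scale_edge (x y : scale_vertex) : bool :=
  match x, y with
  | None, None => false
  | None, Some (_, h) | Some (_, h), None => h == root_vertex H
  | Some (i, h), Some (j, h') => (i == j) && edge h h'
  end.

Lemma scale_edge_sym : symmetric scale_edge.
Proof.
by move=> [[i h]|] [[j h']|] //=; rewrite eq_sym edge_sym.
Qed.

Lemma scale_edge_irrefl : irreflexive scale_edge.
Proof. by move=> [[i h]|] //=; rewrite edge_irrefl andbF. Qed.

Definition scale_graph : sgraph := SGraph scale_edge_sym scale_edge_irrefl.
Definition scale_center : scale_graph := (None : scale_vertex).
End ScaleGraph.

Section Attach.
Variables (G H : rooted_graph) (k : nat).

Definition attach_vertex : finType := (G + scale_graph H k)%type.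

Definition attach_edge (x y : attach_vertex) : bool :=
  match x, y with
  | inl g, inl g' => edge g g'
  | inr z, inr z' => edge z z'
  | inl g, inr z | inr z, inl g =>
      (g == root_vertex G) && (z == scale_center H k)
  end.

Lemma attach_edge_sym : symmetric attach_edge.
Proof. by move=> [g|z] [g'|z'] //; exact: edge_sym. Qed.

Lemma attach_edge_irrefl : irreflexive attach_edge.
Proof. by move=> [g|z]; exact: edge_irrefl. Qed.

Definition attach : rooted_graph :=
  @RootedGraph (SGraph attach_edge_sym attach_edge_irrefl)
          (inl (root_vertex G) : attach_vertex).
End Attach.

(* (G^v : H^w)_{i_1, ..., i_j}, the last index of the sequence being attached
   last. *)
Definition attach_seq (G H : rooted_graph) (s : seq nat) : rooted_graph :=
  foldl (fun K i => attach K H i) G s.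

(* For sequences of independence polynomials R is {poly int}: 'X in {poly R} is
   the variable r of the characteristic polynomial, and x lives in R. The order
   n and the coefficients c are determined by chi. *)
Definition linearly_recurrent (R : comNzRingType) (p : nat -> R)
    (chi : {poly R}) : Prop :=
  exists (n : nat) (c : 'I_n -> R),
    chi = 'X^n - \sum_(i < n) c i *: 'X^i /\
    forall k : nat, (n <= k)%N -> p k = \sum_(i < n) c i * p (k - n + i)%N.

(* Main.v *)
(** Let [a], [b], [A], [D] be the independence polynomials of [H], [H \ w], [G]
    and [G \ v]. Splitting independent sets according to whether they contain
    the new vertex v_0, attaching [Z_k(H^w)] replaces the pair [(A, D)] by
    [(A a^k + x D b^k, D (a^k + x b^k))]. Starting from constants, after [m]
    attachments both entries are combinations of the sequences
    [(b^(m-j) a^j)^k], [0 <= j <= m], with coefficients independent of [k], even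
    if indices are shifted by constants. Any monic polynomial vanishing at these
    ratios is then a characteristic polynomial; in the
    second claim, the factor [chi_2] already vanishes there. *)
Require Import Defs.
From mathcomp Require Import all_boot ssralg ssrint poly ring.

Set Implicit Arguments.
Unset Strict Implicit.
Unset Printing Implicit Defensive.

Import GRing.Theory.
Local Open Scope ring_scope.

(** * Exponential sums and their recurrences *)

Definition exp_sum (R : comNzRingType) (a b : R) (m : nat) (p : nat -> R) :=
  exists c : nat -> R,
    forall k, p k = \sum_(j < m.+1) c j * (b ^+ (m - j) * a ^+ j) ^+ k.

Section ExpSum.
Variables (R : comNzRingType) (a b : R).
Implicit Types (m : nat) (p q : nat -> R).

Lemma exp_sum_const u : exp_sum a b 0 (fun=> u).
Proof.
exists (fun=> u) => k.
by rewrite big_ord_recl big_ord0 !expr0 mulr1 expr1n mulr1 addr0.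
Qed.

Lemma eq_exp_sum m p q : p =1 q -> exp_sum a b m p -> exp_sum a b m q.
Proof. by move=> pq [c pE]; exists c => k; rewrite -pq. Qed.

Lemma exp_sumD m p q :
  exp_sum a b m p -> exp_sum a b m q -> exp_sum a b m (fun k => p k + q k).
Proof.
move=> [c pE] [d qE]; exists (fun j => c j + d j) => k.
by rewrite pE qE -big_split; apply: eq_bigr => j _; rewrite mulrDl.
Qed.

Lemma exp_sumZ u m p : exp_sum a b m p -> exp_sum a b m (fun k => u * p k).
Proof.
move=> [c pE]; exists (fun j => u * c j) => k.
by rewrite pE mulr_sumr; apply: eq_bigr => j _; rewrite mulrA.
Qed.

(** The extra factor [a] turns the ratio of index [j] into that of index [j + 1] at level [m.+1], so
    the coefficients shift and index 0 gets 0. *)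
Lemma exp_sumMl m p :
  exp_sum a b m p -> exp_sum a b m.+1 (fun k => p k * a ^+ k).
Proof.
move=> [c pE]; exists (fun j => if j is j'.+1 then c j' else 0) => k.
rewrite pE [RHS]big_ord_recl /= mul0r add0r mulr_suml; apply: eq_bigr => j _.
by rewrite /bump /= add1n subSS -mulrA -exprMn exprSr mulrA.
Qed.

(** Here the index [j] is kept, since only the exponent of [b] grows; the new index [m.+1] gets
    coefficient 0. *)
Lemma exp_sumMr m p :
  exp_sum a b m p -> exp_sum a b m.+1 (fun k => p k * b ^+ k).
Proof.
move=> [c pE]; exists (fun j => if (j <= m)%N then c j else 0) => k.
rewrite pE [RHS]big_ord_recr /= ltnn mul0r addr0 mulr_suml; apply: eq_bigr => j _.
have le_jm : (j <= m)%N by rewrite -ltnS.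
rewrite le_jm subSn // exprS -mulrA -exprMn.
by congr (_ * _ ^+ k); rewrite mulrC mulrA.
Qed.

(** For a root [t] of a monic [chi] of degree [n], [t ^+ n] is a combination of lower powers;
    multiplying by [t ^+ (k - n)] gives the recurrence for [t ^+ k], and it passes to linear
    combinations. *)
Lemma exp_sum_recurrent m p (chi : {poly R}) :
    exp_sum a b m p -> chi \is monic ->
    (forall j : 'I_m.+1, root chi (b ^+ (m - j) * a ^+ j)) ->
  linearly_recurrent p chi.
Proof.
move=> [c pE] chi_monic chi_root.
set n := (size chi).-1.
have size_chi : size chi = n.+1 by rewrite prednK // size_poly_gt0 monic_neq0.
have lead1 : chi`_n = 1 by exact/monicP.
have root_exp t : root chi t -> t ^+ n = \sum_(i < n) - chi`_i * t ^+ i.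
  move=> /rootP; rewrite horner_coef size_chi big_ord_recr /= lead1 mul1r addrC.
  by move/eqP; rewrite addr_eq0 -sumrN => /eqP->; apply: eq_bigr => i _; rewrite mulNr.
exists n, (fun i => - chi`_i); split=> [|k le_n_k].
  under eq_bigr do rewrite scaleNr.
  rewrite sumrN opprK -[LHS]coefK poly_def size_chi big_ord_recr /= lead1 scale1r.
  exact: addrC.
under [RHS]eq_bigr do rewrite pE mulr_sumr.
rewrite exchange_big pE; apply: eq_bigr => j _ /=.
rewrite -{1}(subnK le_n_k) exprD root_exp // !mulr_sumr; apply: eq_bigr => i _.
by rewrite exprD; ring.
Qed.
End ExpSum.

(** * Independence polynomials as sums over independent sets *)

Lemma independentP (G : sgraph) (S : {set G}) :
  reflect {in S &, forall x y, ~~ edge x y} (independent S).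
Proof.
apply: (iffP forallP) => [indS x y xS yS | indS x].
  by have /implyP/(_ xS)/forallP/(_ y)/implyP/(_ yS) := indS x.
by apply/implyP => xS; apply/forallP => y; apply/implyP => yS; exact: indS.
Qed.

Lemma indep_polyE (G : sgraph) :
  indep_poly G = \sum_(S : {set G} | independent S) 'X^#|S|.
Proof.
have card_lt (S : {set G}) : (#|S| < #|G|.+1)%N by rewrite ltnS max_card.
rewrite (partition_big (fun S => Ordinal (card_lt S)) xpredT) //=.
apply: eq_bigr => i _; rewrite (eq_bigr (fun=> 'X^i)) => [|S /andP[_ /eqP <-] //].
by rewrite sumr_const scaler_nat /indep_count; congr (_ *+ _); apply: eq_card => S;
  rewrite inE.
Qed.

Lemma indep_poly_delete (G : sgraph) (w : G) :
  indep_poly (delete_vertex w) =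
  \sum_(S : {set G} | independent S && (w \notin S)) 'X^#|S|.
Proof.
pose emb (S : {set del_vertex w}) : {set G} := val @: S.
(* Image and preimage under [val] match the subsets of the subtype with the subsets avoiding [w]. *)
rewrite indep_polyE (reindex_onto emb (fun S => val @^-1: S)) /=; last first.
  move=> S /andP[_ wS]; apply/setP => x; apply/imsetP/idP => [[y]|xS].
    by rewrite inE => ? ->.
  have xw : x != w by apply: contraNneq wS => <-.
  by exists (Sub x xw); rewrite ?inE.
apply: eq_big => [S|S _]; last by rewrite card_imset //; exact: val_inj.
have -> : val @^-1: emb S == S.
  by apply/eqP/setP => x; rewrite inE mem_imset //; exact: val_inj.
have -> : w \notin emb S.
  by apply/imsetP => -[x _ wE]; have := valP x; rewrite -wE eqxx.
rewrite !andbT; apply/independentP/independentP => indS.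
  by move=> _ _ /imsetP[x xS ->] /imsetP[y yS ->]; exact: indS.
by move=> x y xS yS; apply: indS; apply: imset_f.
Qed.

(** * The scale graph *)

Section ScalePoly.
Variables (H : rooted_graph) (k : nat).
Local Notation w := (root_vertex H).

(** The flag records whether v_0 is chosen, the function the trace on each copy of [H]. *)
Definition scale_set (u : bool * {ffun 'I_k -> {set H}}) : {set scale_graph H k} :=
  [set z | if z is Some (i, h) then h \in u.2 i else u.1].

Lemma scale_set_bij : bijective scale_set.
Proof.
exists (fun S : {set scale_graph H k} =>
  (scale_center H k \in S, [ffun i => [set h | (Some (i, h) : scale_graph H k) \in S]])).
  move=> [c f]; rewrite inE; congr pair; apply/ffunP => i; rewrite ffunE.
  by apply/setP => h; rewrite !inE.
by move=> S; apply/setP => -[[i h]|]; rewrite !inE // ffunE inE.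
Qed.

Lemma card_scale_set u : #|scale_set u| = (u.1 + \sum_i #|u.2 i|)%N.
Proof.
rewrite -sum1_card big_mkcond /= (bigID (pred1 None)) /= big_pred1_eq inE.
congr (_ + _)%N.
rewrite (reindex_omap (Some : _ -> scale_graph H k) id) /=; last by case.
rewrite (eq_bigl xpredT) => [|i]; last by rewrite eqxx.
transitivity (\sum_(i < k) \sum_(h : H) if h \in u.2 i then 1%N else 0%N).
  by rewrite pair_big; apply: eq_bigr => -[i h] _; rewrite inE.
by apply: eq_bigr => i _; rewrite -big_mkcond sum1_card.
Qed.

Lemma independent_scale_set u :
  independent (scale_set u) =
  [forall i, independent (u.2 i) && (u.1 ==> (w \notin u.2 i))].
Proof.
apply/independentP/forallP => [indS i | indf].
  apply/andP; split.
    apply/independentP => x y xi yi.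
    by have := indS (Some (i, x)) (Some (i, y)); rewrite /= !inE eqxx; apply.
  apply/implyP => u1; apply/negP => wi.
  by have /= := indS None (Some (i, w)); rewrite !inE eqxx => /(_ u1 wi).
have root_out i h : u.1 -> h \in u.2 i -> h != w.
  move=> u1 hi; have /andP[_ /implyP/(_ u1)] := indf i.
  by apply: contraNneq => <-.
move=> [[i x]|] [[j y]|]; rewrite !inE //= => xS yS; try exact: root_out xS.
  apply/nandP; case: eqP => [ij|]; [right | by left].
  rewrite -ij in yS; have /andP[/independentP ind_i _] := indf i; exact: ind_i.
exact: root_out yS.
Qed.

(** Once membership of v_0 is fixed, the traces on the copies are chosen independently, each
    avoiding the root if v_0 is present. As an exponent, [c] counts v_0 itself. *)
Lemma scale_poly_with (c : bool) :
  \sum_(S : {set scale_graph H k} |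
      independent S && ((scale_center H k \in S) == c)) 'X^#|S|
  = 'X^c * (if c then indep_poly (delete_vertex w) else indep_poly H) ^+ k
  :> {poly int}.
Proof.
rewrite (reindex scale_set) /=; last exact/onW_bij/scale_set_bij.
pose Q := [pred S : {set H} | independent S && (c ==> (w \notin S))].
transitivity (\sum_(f : {ffun 'I_k -> {set H}} | f \in ffun_on Q)
    'X^c * \prod_i ('X^#|f i| : {poly int})).
  rewrite (reindex_onto (pair c) snd) /=; last first.
    by move=> [d f] /andP[_]; rewrite inE /= => /eqP ->.
  apply: eq_big => [f|f _]; last by rewrite card_scale_set exprD expr_sum.
  rewrite independent_scale_set inE /= !eqxx !andbT.
  by apply/forallP/ffun_onP => indf i; have := indf i; rewrite ?inE.
(* Distributivity turns the sum over families of traces into a product of [k] equal sums. *)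
rewrite -mulr_sumr -(bigA_distr_big _ (fun _ (S : {set H}) => 'X^#|S|)) prodr_const card_ord.
congr (_ * _ ^+ k); case: (c) @Q => Q; rewrite /Q /=.
  by rewrite indep_poly_delete.
by rewrite indep_polyE; apply: eq_bigl => S; rewrite andbT.
Qed.

End ScalePoly.

(** * Attaching one scale graph *)

Section AttachPoly.
Variables (G H : rooted_graph) (k : nat).
Local Notation v := (root_vertex G).
Local Notation w := (root_vertex H).
Local Notation v0 := (scale_center H k).

Definition attach_set (u : {set G} * {set scale_graph H k}) : {set attach G H k} :=
  [set z | match z with inl g => g \in u.1 | inr z => z \in u.2 end].

Lemma attach_set_bij : bijective attach_set.
Proof.
exists (fun S : {set attach G H k} =>
  ([set g | (inl g : attach G H k) \in S], [set z | (inr z : attach G H k) \in S])).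
  by move=> [A B]; congr pair; apply/setP => x; rewrite !inE.
by move=> S; apply/setP => -[g|z]; rewrite !inE.
Qed.

Lemma card_attach_set u : #|attach_set u| = (#|u.1| + #|u.2|)%N.
Proof.
rewrite -!sum1_card big_mkcond /= big_sumType /=.
by congr (_ + _)%N; rewrite [RHS]big_mkcond; apply: eq_bigr => x _; rewrite inE.
Qed.

Lemma independent_attach_set u :
  independent (attach_set u) =
  [&& independent u.1, independent u.2 & ~~ ((v \in u.1) && (v0 \in u.2))].
Proof.
apply/independentP/and3P => [indS|[/independentP indA /independentP indB vv0]].
  split; try apply/independentP => x y xS yS.
  - by have := indS (inl x) (inl y); rewrite !inE; apply.
  - by have := indS (inr x) (inr y); rewrite !inE; apply.
  apply/negP => /andP[vA v0B].
  by have := indS (inl v) (inr v0); rewrite !inE /= !eqxx => /(_ vA v0B).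
move=> [x|x] [y|y]; rewrite !inE /= => xS yS; [exact: indA| | |exact: indB].
  by apply: contra vv0 => /andP[/eqP <- /eqP <-]; rewrite xS.
by apply: contra vv0 => /andP[/eqP <- /eqP <-]; rewrite yS.
Qed.

(** Without v_0, the choices in [G] and in the copies are free; with v_0, both [v] and the roots of
    all copies are excluded. *)
Lemma indep_poly_attach :
  indep_poly (attach G H k) =
  indep_poly G * indep_poly H ^+ k +
  'X * (indep_poly (delete_vertex v) * indep_poly (delete_vertex w) ^+ k).
Proof.
have := scale_poly_with H k false; have := scale_poly_with H k true => /=.
rewrite expr0 mul1r expr1 => in_sum <-; rewrite mulrCA -in_sum.
rewrite indep_poly_delete (indep_polyE G) !big_distrlr /= !pair_big /=.
rewrite indep_polyE (reindex attach_set) /=; last exact/onW_bij/attach_set_bij.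
rewrite [LHS](bigID (fun u : {set G} * {set scale_graph H k} => v0 \in u.2)) /= addrC.
congr (_ + _); apply: eq_big => u; rewrite ?card_attach_set ?exprD //.
  by rewrite independent_attach_set; case: (_ \in u.2); rewrite /= ?andbF ?andbT.
rewrite independent_attach_set; case: (_ \in u.2); rewrite /= ?andbF ?andbT //.
by rewrite andbAC andbA.
Qed.

(** With [v] gone the edge to v_0 disappears, so the polynomial of the whole scale graph splits off
    as a factor. *)
Lemma indep_poly_delete_attach :
  indep_poly (delete_vertex (root_vertex (attach G H k))) =
  indep_poly (delete_vertex v) *
  (indep_poly H ^+ k + 'X * indep_poly (delete_vertex w) ^+ k).
Proof.
have := scale_poly_with H k false; have := scale_poly_with H k true => /=.
rewrite expr0 mul1r expr1 => <- <-.
under eq_bigl do rewrite eqbF_neg; under [X in _ + X]eq_bigl do rewrite eqb_id.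
rewrite addrC -bigID !indep_poly_delete big_distrlr pair_big /=.
rewrite (reindex attach_set) /=; last exact/onW_bij/attach_set_bij.
apply: eq_big => u; rewrite ?card_attach_set ?exprD // independent_attach_set inE.
by case: (v \in u.1); rewrite /= ?andbF ?andbT.
Qed.

End AttachPoly.

(** * Iterated attachment *)

Section AttachSeq.
Variables G H : rooted_graph.
Local Notation a := (indep_poly H).
Local Notation b := (indep_poly (delete_vertex (root_vertex H))).

(** The shift [d] only contributes the constant factors [a ^+ d] and [b ^+ d]. Both polynomials are
    carried along because the recursion couples them. *)
Lemma exp_sum_attach (F : nat -> rooted_graph) (d m : nat) :
    exp_sum a b m (fun k => indep_poly (F k)) ->
    exp_sum a b m (fun k => indep_poly (delete_vertex (root_vertex (F k)))) ->
  exp_sum a b m.+1 (fun k => indep_poly (attach (F k) H (k + d))) /\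
  exp_sum a b m.+1
    (fun k => indep_poly (delete_vertex (root_vertex (attach (F k) H (k + d))))).
Proof.
move=> Fexp Dexp.
have Fa := exp_sumZ (a ^+ d) (exp_sumMl Fexp).
have Da := exp_sumZ (a ^+ d) (exp_sumMl Dexp).
have Db := exp_sumZ ('X * b ^+ d) (exp_sumMr Dexp).
split; [apply: eq_exp_sum (exp_sumD Fa Db) | apply: eq_exp_sum (exp_sumD Da Db)] => k.
  by rewrite indep_poly_attach !exprD; congr (_ + _); ring.
by rewrite indep_poly_delete_attach !exprD; ring.
Qed.

Lemma exp_sum_attach_nseq (m : nat) :
  exp_sum a b m (fun k => indep_poly (attach_seq G H (nseq m k))) /\
  exp_sum a b m
    (fun k => indep_poly (delete_vertex (root_vertex (attach_seq G H (nseq m k))))).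
Proof.
elim: m => [|m [IH IHd]].
  split; first exact: (exp_sum_const _ _ (indep_poly G)).
  exact: (exp_sum_const _ _ (indep_poly (delete_vertex (root_vertex G)))).
have [Aexp Dexp] := exp_sum_attach 0 IH IHd.
(* The new index is split off at the end of the sequence, where [foldl] attaches last. *)
by split; [apply: eq_exp_sum Aexp | apply: eq_exp_sum Dexp] => k;
  rewrite addn0 -addn1 nseqD /attach_seq foldl_cat.
Qed.

End AttachSeq.

Theorem theorem3p5 (G H : rooted_graph) (m : nat) :
  let a := indep_poly H in
  let b := indep_poly (delete_vertex (root_vertex H)) in
  let chi := fun n : nat => \prod_(j < n.+1) ('X - (b ^+ (n - j) * a ^+ j)%:P) in
  linearly_recurrent
    (fun k : nat => indep_poly (attach_seq G H (nseq m k))) (chi m) /\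
  linearly_recurrent
    (fun k : nat => indep_poly (attach_seq G H [:: k; (k + m + 1)%N]))
    (('X + (b * a)%:P) * chi 2%N).
Proof.
move=> a b chi.
have chi_monic n : chi n \is monic by apply: monic_prod => j _; exact: monicXsubC.
have chi_root n (j : 'I_n.+1) : root (chi n) (b ^+ (n - j) * a ^+ j).
  by rewrite /chi (bigD1 j) //= rootM root_XsubC eqxx.
split; first exact: exp_sum_recurrent (exp_sum_attach_nseq G H m).1 _ _.
apply: (@exp_sum_recurrent _ a b 2) => [||j].
- have [Aexp Dexp] := exp_sum_attach_nseq G H 1.
  (* One attachment of index [k], then a second with shift [m + 1], reaches level 2. *)
  apply: eq_exp_sum (exp_sum_attach (m + 1) Aexp Dexp).1 => k.
  by rewrite addnA.
(* The extra factor is monic when read as ['X - (- (b * a))%:P]. *)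
- by rewrite monicMl // -[_%:P]opprK -polyCN monicXsubC.
by rewrite rootM chi_root orbT.
Qed.
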